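(* For all integers $m,n,s\ge 0$ and every complex $d$ with $\mathrm{Re}(d)>0$, \[ {}_4F_3\!\left(\begin{matrix}1+2m,\ 1+2n,\ 1+m+n+s,\ d+1\\ m+n+\tfrac32,\ 3+2m+2n+2s,\ d\end{matrix};1\right) =\frac{\pi}{4}\,\frac{(\tfrac32)_{m+n+s}(\tfrac32)_{m+n}(\tfrac12)_s}{(\tfrac12)_m(\tfrac12)_n\,m!\,n!} \left[\pi\,\frac{(\tfrac12)_m(\tfrac12)_n}{(m+s)!\,(n+s)!}+\frac{1}{\pi}\,\frac{\big(\frac{2+2m+2n+2s}{d}-1\big)\,m!\,n!}{(\tfrac12)_{m+s+1}(\tfrac12)_{n+s+1}}\right]. \]
   Context: For $\lambda\in\mathbb{C}$ and integer $n\ge0$, $(\lambda)_n$ is the Pochhammer symbol: $(\lambda)_0=1$, $(\lambda)_n=\lambda(\lambda+1)\cdots(\lambda+n-1)$ for $n\ge1$. The generalized hypergeometric series is ${}_pF_q\!\left(\begin{matrix}\alpha_1,\dots,\alpha_p\\ \beta_1,\dots,\beta_q\end{matrix};z\right)=\sum_{k=0}^\infty \frac{(\alpha_1)_k\cdots(\alpha_p)_k}{(\beta_1)_k\cdots(\beta_q)_k}\frac{z^k}{k!}$; for $p=q+1$ and $z=1$ it converges when $\mathrm{Re}\big(\sum_j\beta_j-\sum_j\alpha_j\big)>0$. *)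

(* Defs.v *)
From Stdlib Require Import Reals Factorial List.
From Coquelicot Require Import Coquelicot.
Open Scope C_scope.

(* The Pochhammer symbol (a)_n = a (a + 1) ... (a + n - 1). *)
Fixpoint poch (a : C) (n : nat) : C :=
  match n with
  | O => 1
  | S k => poch a k * (a + INR k)
  end.

Definition Cprod (l : list C) : C := fold_right Cmult 1 l.

(* The lower parameters are meant not to be nonpositive integers: division in C
   is total, so the definition itself does not exclude them. *)
Definition pFq_term (alphas betas : list C) (z : C) (k : nat) : C :=
  Cprod (map (fun a => poch a k) alphas) / Cprod (map (fun b => poch b k) betas)
  * (z ^ k / INR (fact k)).

(* Relational, so that convergence of the series is part of the assertion that
   pFq takes the value v. *)
Definition is_pFq (alphas betas : list C) (z v : C) : Prop :=
  is_series (pFq_term alphas betas z) v.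

(* Main.v *)
(* Since (d+1)_k / (d)_k = 1 + k/d, the series is affine in 1/d.  Put a = 1+2m,
   b = 1+2n, c = 1+m+n+s, so that the other parameters are (a+b+1)/2 and 2c+1.
   At d = 2c the series is Watson's 3F2(a, b, c; (a+b+1)/2, 2c; 1), and the
   coefficient of 1/d is, after a shift of the index, a multiple of Watson's
   series at (a+1, b+1, c+1).  Watson's series is summed from (1, 1, 1) and
   (2, 2, 2) by the moves c -> c+1 and (a, c) -> (a+2, c+1): each multiplies the
   sum by a rational factor, because the corresponding combination of summands
   telescopes with an explicit rational certificate.  The series at (2, 2, 2)
   telescopes to 9; the one at (1, 1, 1) is pi^2/4, the partial sums being
   expressed by the integrals of t cos(t)^(2n) over [0, pi/2]. *)
Require Import Defs.
From Stdlib Require Import Reals Factorial List Lra Lia.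
From Coquelicot Require Import Coquelicot.
Import ListNotations.
Open Scope R_scope.

(** * Real Pochhammer symbols and telescoping series *)

(** The real counterpart of [poch]: Watson's series has real parameters here, so positivity and
    order arguments apply. [poch_RtoC] links the two. *)
Fixpoint rpoch (a : R) (n : nat) : R :=
  match n with
  | O => 1
  | S k => rpoch a k * (a + INR k)
  end.

Lemma rpoch_pos (a : R) (n : nat) : 0 < a -> 0 < rpoch a n.
Proof.
  intros Ha; induction n as [|n IH]; simpl; [lra|].
  apply Rmult_lt_0_compat; [exact IH|]. pose proof (pos_INR n); lra.
Qed.

Lemma rpoch_neq0 (a : R) (n : nat) : 0 < a -> rpoch a n <> 0.
Proof. intros Ha; apply Rgt_not_eq, rpoch_pos, Ha. Qed.

Lemma rpoch_shift (a : R) (n : nat) :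
  a * rpoch (a + 1) n = rpoch a n * (a + INR n).
Proof.
  induction n as [|n IH]; [simpl; ring|].
  rewrite S_INR; simpl rpoch.
  rewrite <- Rmult_assoc, IH; ring.
Qed.

(** Serves as a rewrite rule: it reduces shifted symbols to common atoms, after which [field]
    decides identities between summands. *)
Lemma rpoch_add1 (a : R) (n : nat) :
  0 < a -> rpoch (a + 1) n = rpoch a n * (a + INR n) / a.
Proof. intros Ha; rewrite <- rpoch_shift; field; lra. Qed.

Lemma rpoch_1 (n : nat) : rpoch 1 n = INR (fact n).
Proof.
  induction n as [|n IH]; [reflexivity|].
  rewrite fact_simpl, mult_INR, S_INR; simpl rpoch; rewrite IH; ring.
Qed.

Lemma is_series_telescope (u g : nat -> R) (l : R) :
  (forall k, u k = g k - g (S k)) -> is_lim_seq g l -> is_series u (g O - l).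
Proof.
  intros Hu Hg.
  change (is_lim_seq (sum_n u) (g O - l)).
  apply (is_lim_seq_ext (fun n => g O - g (S n))).
  - intros n; induction n as [|n IH].
    + rewrite sum_O, Hu; reflexivity.
    + rewrite sum_Sn, <- IH, Hu; unfold plus; simpl; ring.
  - apply (is_lim_seq_minus' (fun _ => g O) (fun n => g (S n))).
    + apply is_lim_seq_const.
    + exact (proj1 (is_lim_seq_incr_1 g l) Hg).
Qed.

(** * The Wallis ratio and its decay *)

(** Equal to (2k)!!/(2k+1)!!, the integral of sin(t)^(2k+1) over [0, pi/2]. *)
Definition wallis (k : nat) : R := INR (fact k) / rpoch (3 / 2) k.

Lemma wallis_S (k : nat) :
  wallis (S k) = wallis k * ((INR k + 1) / (3 / 2 + INR k)).
Proof.
  unfold wallis; rewrite fact_simpl, mult_INR, S_INR; simpl rpoch.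
  pose proof (pos_INR k); field; split; [lra|apply rpoch_neq0; lra].
Qed.

Lemma wallis_pos (k : nat) : 0 < wallis k.
Proof.
  apply Rdiv_lt_0_compat; [apply INR_fact_lt_0|apply rpoch_pos; lra].
Qed.

(** The induction step amounts to (k+1)(k+2) <= (k+3/2)^2, whose two sides differ by 1/4. *)
Lemma wallis_sqr_le (k : nat) : (wallis k) ^ 2 <= / (INR k + 1).
Proof.
  induction k as [|k IH].
  - unfold wallis; simpl; lra.
  - rewrite wallis_S, S_INR; pose proof (pos_INR k) as Hk.
    set (x := INR k) in *.
    apply Rle_trans with (/ (x + 1) * ((x + 1) / (3 / 2 + x)) ^ 2).
    + rewrite Rpow_mult_distr; apply Rmult_le_compat_r; [apply pow2_ge_0|exact IH].
    + apply Rminus_le_0.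
      replace (/ (x + 1 + 1) - / (x + 1) * ((x + 1) / (3 / 2 + x)) ^ 2)
        with (/ 4 / ((x + 1 + 1) * (3 / 2 + x) ^ 2)) by (field; lra).
      apply Rlt_le, Rdiv_lt_0_compat; [lra|].
      apply Rmult_lt_0_compat; [lra|apply pow_lt; lra].
Qed.

Lemma wallis_lim : is_lim_seq wallis 0.
Proof.
  apply (is_lim_seq_le_le (fun _ => 0) _ (fun k => sqrt (/ (INR k + 1)))).
  - intros k; split; [apply Rlt_le, wallis_pos|].
    rewrite <- (sqrt_pow2 (wallis k)) by apply Rlt_le, wallis_pos.
    apply sqrt_le_1_alt, wallis_sqr_le.
  - apply is_lim_seq_const.
  - rewrite <- sqrt_0.
    apply (is_lim_seq_continuous sqrt); [apply continuity_pt_sqrt; lra|].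
    apply (is_lim_seq_ext (fun k => / INR (S k))).
    { intros k; rewrite S_INR; reflexivity. }
    apply (is_lim_seq_incr_1 (fun k => / INR k)).
    replace (Finite 0) with (Rbar_inv p_infty) by reflexivity.
    apply is_lim_seq_inv; [apply is_lim_seq_INR|discriminate].
Qed.

(* The summand of Watson's series at a = b = c = 1; every other Watson series
   considered is dominated by it. *)
Definition base_term (k : nat) : R := wallis k / (INR k + 1).

(** * Cosine moments and the sum of the base series *)

Definition cos_moment (n : nat) : R := RInt (fun t => t * cos t ^ (2 * n)) 0 (PI / 2).

Lemma cos_moment_ex (n : nat) :
  ex_RInt (fun t => t * cos t ^ (2 * n)) 0 (PI / 2).
Proof.
  apply (ex_RInt_continuous (V := R_CompleteNormedModule)); intros t _.
  apply (ex_derive_continuous (fun t => t * cos t ^ (2 * n)) t); auto_derive; auto.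
Qed.

Lemma cos_moment_0 : cos_moment 0 = PI ^ 2 / 8.
Proof.
  apply is_RInt_unique.
  replace (PI ^ 2 / 8) with (minus ((PI / 2) ^ 2 / 2) (0 ^ 2 / 2))
    by (unfold minus, plus, opp; simpl; field).
  apply (is_RInt_derive (fun t => t ^ 2 / 2)).
  - intros t _; auto_derive; auto; simpl; field.
  - intros t _; apply (ex_derive_continuous (fun t => t * cos t ^ (2 * 0)) t); auto_derive; auto.
Qed.

Lemma cos_moment_is_RInt (n : nat) :
  is_RInt (fun t => t * cos t ^ (2 * n)) 0 (PI / 2) (cos_moment n).
Proof. exact (RInt_correct (V := R_CompleteNormedModule) _ _ _ (cos_moment_ex n)). Qed.

(** Integration by parts, carried out through an explicit antiderivative of the combination of the
    two integrands. *)
Lemma cos_moment_S (n : nat) :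
  2 * (INR n + 1) * cos_moment (S n)
    = (2 * INR n + 1) * cos_moment n - / (2 * (INR n + 1)).
Proof.
  pose proof (pos_INR n) as Hn.
  set (G := fun t => 2 * (INR n + 1) * (t * cos t ^ (2 * S n))
                     - (2 * INR n + 1) * (t * cos t ^ (2 * n))).
  assert (H1 : is_RInt G 0 (PI / 2) (- / (2 * (INR n + 1)))).
  (* The second summand of [F] cancels the term sin(t) cos(t)^(2n+1) produced by differentiating the
     factor t of the first. The constant comes from [F] at 0, since [F] vanishes at pi/2. *)
  { set (F := fun t => t * sin t * cos t ^ (2 * n + 1)
                       + cos t ^ (2 * n + 2) / (2 * (INR n + 1))).
    replace (- / (2 * (INR n + 1))) with (minus (F (PI / 2)) (F 0)).
    2:{ unfold F; rewrite cos_PI2, cos_0, sin_0, !pow1, !pow_i by lia.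
        unfold minus, plus, opp; simpl; field; lra. }
    apply (is_RInt_derive F G).
    - intros t _; unfold F, G; auto_derive; [exact I|].
      replace (n + (n + 0) + 1)%nat with (S (2 * n)) by lia.
      replace (n + (n + 0) + 2)%nat with (S (S (2 * n))) by lia.
      replace (2 * S n)%nat with (S (S (2 * n)))%nat by lia.
      rewrite !S_INR, mult_INR; rewrite !Nat.pred_succ; rewrite <- !tech_pow_Rmult.
      set (p := cos t ^ (2 * n)).
      pose proof (sin2_cos2 t) as Hs; unfold Rsqr in Hs.
      replace (INR 2) with 2 by (simpl; lra).
      transitivity (t * p * (cos t * cos t - (2 * INR n + 1) * (sin t * sin t))).
      + field; lra.
      + replace (sin t * sin t) with (1 - cos t * cos t) by lra; ring.
    - intros t _.
      apply (ex_derive_continuous G); unfold G; auto_derive; exact I. }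
  assert (H2 : is_RInt G 0 (PI / 2) (2 * (INR n + 1) * cos_moment (S n)
                                     - (2 * INR n + 1) * cos_moment n)).
  { apply (is_RInt_minus (V := R_NormedModule));
      apply (is_RInt_scal (V := R_NormedModule)), cos_moment_is_RInt. }
  apply (is_RInt_unique (V := R_CompleteNormedModule)) in H1.
  apply (is_RInt_unique (V := R_CompleteNormedModule)) in H2.
  lra.
Qed.

(** Since t cos(t) <= sin(t) on [0, pi/2], the integrand is at most sin(t) cos(t)^(2n+1), which has
    an elementary antiderivative. *)
Lemma cos_moment_bounds (n : nat) : 0 <= cos_moment (S n) <= / (2 * (INR n + 1)).
Proof.
  pose proof PI_RGT_0 as Hpi; pose proof (pos_INR n) as Hn.
  assert (Hcos : forall t, 0 < t < PI / 2 -> 0 < cos t)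
    by (intros t Ht; apply cos_gt_0; lra).
  split.
  - apply (is_RInt_ge_0 (fun t => t * cos t ^ (2 * S n)) 0 (PI / 2)); [lra|apply cos_moment_is_RInt|].
    intros t Ht; apply Rmult_le_pos; [lra|apply pow_le, Rlt_le, Hcos; exact Ht].
  - set (F := fun t => - cos t ^ (2 * n + 2) / (2 * (INR n + 1))).
    apply (is_RInt_le (fun t => t * cos t ^ (2 * S n)) (fun t => sin t * cos t ^ (2 * n + 1))
             0 (PI / 2)); [lra|apply cos_moment_is_RInt| |].
    + replace (/ (2 * (INR n + 1))) with (minus (F (PI / 2)) (F 0)).
      2:{ unfold F; rewrite cos_PI2, cos_0, !pow1, !pow_i by lia.
          unfold minus, plus, opp; simpl; field; lra. }
      apply (is_RInt_derive F).
      * intros t _; unfold F; auto_derive; [exact I|].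
        replace (n + (n + 0) + 2)%nat with (S (S (2 * n))) by lia.
        replace (2 * n + 1)%nat with (S (2 * n)) by lia.
        rewrite !S_INR, mult_INR; rewrite !Nat.pred_succ.
        replace (INR 2) with 2 by (simpl; lra).
        field; lra.
      * intros t _.
        apply (ex_derive_continuous (fun t => sin t * cos t ^ (2 * n + 1))); auto_derive; exact I.
    + intros t Ht.
      replace (2 * S n)%nat with (S (2 * n + 1)) by lia; rewrite <- tech_pow_Rmult, <- Rmult_assoc.
      apply Rmult_le_compat_r; [apply pow_le, Rlt_le, Hcos; exact Ht|].
      (* sin(t) - t cos(t) vanishes at 0 and has derivative t sin(t) >= 0. *)
      destruct (MVT_gen (fun t => sin t - t * cos t) 0 t (fun t => t * sin t))
        as [x [Hx Hd]].
      * intros x _; auto_derive; [exact I|ring].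
      * intros x _; apply continuity_pt_filterlim.
        apply (ex_derive_continuous (fun t => sin t - t * cos t)); auto_derive; exact I.
      * rewrite Rmin_left, Rmax_right in Hx by lra.
        rewrite sin_0, cos_0 in Hd.
        assert (0 <= x * sin x * (t - 0)); [|lra].
        repeat apply Rmult_le_pos; try lra.
        apply sin_ge_0; lra.
Qed.

(** The factor n!/(1/2)_n solves the homogeneous part of the recurrence [cos_moment_S], so that
    consecutive differences become summands. Twice this value is the tail of the base series from
    index n on. *)
Definition scaled_moment (n : nat) : R := cos_moment n * (INR (fact n) / rpoch (1 / 2) n).

Lemma rpoch_half_S (n : nat) : rpoch (1 / 2) (S n) = rpoch (3 / 2) n / 2.
Proof.
  replace (3 / 2) with (1 / 2 + 1) by lra; rewrite rpoch_add1 by lra; simpl; field.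
Qed.

Lemma base_term_telescope (n : nat) :
  base_term n = 2 * scaled_moment n - 2 * scaled_moment (S n).
Proof.
  pose proof (pos_INR n) as Hn.
  unfold scaled_moment.
  replace (cos_moment (S n)) with
    (((2 * INR n + 1) * cos_moment n - / (2 * (INR n + 1))) / (2 * (INR n + 1)))
    by (rewrite <- cos_moment_S; field; lra).
  unfold base_term, wallis.
  replace (rpoch (3 / 2) n) with (2 * rpoch (1 / 2) (S n)) by (rewrite rpoch_half_S; field).
  rewrite fact_simpl, mult_INR, S_INR; simpl rpoch; field.
  repeat split; try lra; apply rpoch_neq0; lra.
Qed.

(** The scaling factor at n+1 is 2(n+1) [wallis n], and the moment bound 1/(2(n+1)) leaves just
    [wallis n]. *)
Lemma scaled_moment_lim : is_lim_seq scaled_moment 0.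
Proof.
  apply (is_lim_seq_incr_1 scaled_moment).
  apply (is_lim_seq_le_le (fun _ => 0) _ wallis).
  - intros n; pose proof (cos_moment_bounds n) as [H0 H1]; pose proof (pos_INR n).
    assert (Hw : INR (fact (S n)) / rpoch (1 / 2) (S n) = 2 * (INR n + 1) * wallis n).
    { rewrite rpoch_half_S, fact_simpl, mult_INR, S_INR; unfold wallis; field.
      apply rpoch_neq0; lra. }
    unfold scaled_moment; rewrite Hw; pose proof (wallis_pos n) as Hp; split.
    + apply Rmult_le_pos; [exact H0|]. apply Rmult_le_pos; lra.
    + apply Rle_trans with (/ (2 * (INR n + 1)) * (2 * (INR n + 1) * wallis n)).
      * apply Rmult_le_compat_r; [apply Rmult_le_pos; lra|exact H1].
      * right; field; lra.
  - apply is_lim_seq_const.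
  - apply wallis_lim.
Qed.

Lemma base_series : is_series base_term (PI ^ 2 / 4).
Proof.
  replace (PI ^ 2 / 4) with (2 * scaled_moment 0 - 2 * 0)
    by (unfold scaled_moment; rewrite cos_moment_0; simpl; field).
  apply (is_series_telescope _ (fun n => 2 * scaled_moment n)).
  - intros k; apply base_term_telescope.
  - apply (is_lim_seq_scal_l scaled_moment 2 0), scaled_moment_lim.
Qed.

(** * Watson's summand and its ratios under shifts *)

Definition watson_term (a b c : R) (k : nat) : R :=
  rpoch a k * rpoch b k * rpoch c k
  / (rpoch ((a + b + 1) / 2) k * rpoch (2 * c) k * INR (fact k)).

Lemma watson_term_pos (a b c : R) (k : nat) :
  0 < a -> 0 < b -> 0 < c -> 0 < watson_term a b c k.
Proof.
  intros Ha Hb Hc; unfold watson_term.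
  apply Rdiv_lt_0_compat; repeat apply Rmult_lt_0_compat;
    try (apply rpoch_pos; lra); apply INR_fact_lt_0.
Qed.

Lemma watson_term_sym (a b c : R) (k : nat) : watson_term b a c k = watson_term a b c k.
Proof.
  unfold watson_term; rewrite (Rplus_comm b a), (Rmult_comm (rpoch b k)); reflexivity.
Qed.

Lemma watson_term_S (a b c : R) (k : nat) :
  0 < a -> 0 < b -> 0 < c ->
  watson_term a b c (S k) = watson_term a b c k *
    ((a + INR k) * (b + INR k) * (c + INR k)
     / (((a + b + 1) / 2 + INR k) * (2 * c + INR k) * (INR k + 1))).
Proof.
  intros Ha Hb Hc; unfold watson_term; pose proof (pos_INR k).
  rewrite fact_simpl, mult_INR, S_INR; simpl rpoch; field.
  repeat split; try lra; try (apply rpoch_neq0; lra); apply INR_fact_neq_0.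
Qed.

Lemma watson_term_shift_c (a b c : R) (k : nat) :
  0 < a -> 0 < b -> 0 < c ->
  watson_term a b (c + 1) k = watson_term a b c k *
    (2 * (2 * c + 1) * (c + INR k) / ((2 * c + INR k) * (2 * c + 1 + INR k))).
Proof.
  intros Ha Hb Hc; unfold watson_term; pose proof (pos_INR k).
  replace (2 * (c + 1)) with (2 * c + 1 + 1) by ring.
  rewrite !rpoch_add1 by lra; field.
  repeat split; try lra; try (apply rpoch_neq0; lra); apply INR_fact_neq_0.
Qed.

(** Raising a by 2 raises (a+b+1)/2 by exactly 1, so the quotient of summands is rational in k. *)
Lemma watson_term_shift_a (a b c : R) (k : nat) :
  0 < a -> 0 < b -> 0 < c ->
  watson_term (a + 2) b (c + 1) k = watson_term a b c k *
    ((a + INR k) * (a + 1 + INR k) * (c + INR k) * ((a + b + 1) * (2 * c + 1))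
     / (a * (a + 1) * ((a + b + 1) / 2 + INR k)
        * ((2 * c + INR k) * (2 * c + 1 + INR k)))).
Proof.
  intros Ha Hb Hc; unfold watson_term; pose proof (pos_INR k).
  replace (2 * (c + 1)) with (2 * c + 1 + 1) by ring.
  replace (a + 2) with (a + 1 + 1) by ring.
  replace ((a + 1 + 1 + b + 1) / 2) with ((a + b + 1) / 2 + 1) by field.
  rewrite !rpoch_add1 by lra; field.
  repeat split; try lra; try (apply rpoch_neq0; lra); apply INR_fact_neq_0.
Qed.

(** * Domination and the two contiguous relations *)

Definition dominated (u v : nat -> R) : Prop :=
  exists M, 0 <= M /\ forall k, u k <= M * v k.

Lemma dominated_trans (u v w : nat -> R) :
  dominated u v -> dominated v w -> dominated u w.
Proof.
  intros [M [HM Hu]] [N [HN Hv]]; exists (M * N); split; [apply Rmult_le_pos; assumption|].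
  intros k; apply Rle_trans with (1 := Hu k); rewrite Rmult_assoc.
  apply Rmult_le_compat_l; [exact HM|apply Hv].
Qed.

(** Makes certificates vanish at infinity: they are of size k times the summand, and k [base_term k]
    <= [wallis k], which tends to 0. *)
Lemma is_lim_seq_dominated (u g : nat -> R) (M : R) :
  dominated u base_term -> (forall k, 0 <= g k <= M * (INR k * u k)) -> 0 <= M ->
  is_lim_seq g 0.
Proof.
  intros [N [HN Hu]] Hg HM.
  apply (is_lim_seq_le_le (fun _ => 0) _ (fun k => M * N * wallis k)).
  - intros k; split; [apply Hg|].
    apply Rle_trans with (1 := proj2 (Hg k)); rewrite Rmult_assoc.
    apply Rmult_le_compat_l; [exact HM|].
    pose proof (pos_INR k) as Hk.
    apply Rle_trans with (INR k * (N * base_term k));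
      [apply Rmult_le_compat_l; [exact Hk|apply Hu]|].
    apply Rminus_le_0.
    replace (N * wallis k - INR k * (N * base_term k)) with (N * base_term k)
      by (unfold base_term; field; lra).
    apply Rmult_le_pos; [exact HN|].
    apply Rlt_le, Rdiv_lt_0_compat; [apply wallis_pos|lra].
  - apply is_lim_seq_const.
  - replace (Finite 0) with (Rbar_mult (M * N) 0) by (simpl; f_equal; ring).
    apply is_lim_seq_scal_l, wallis_lim.
Qed.

(** Summing the relation over k leaves only boundary values of the certificate [g], which vanish at
    both ends; hence A times the sum of [v] is B W. *)
Lemma is_series_contiguous (u v g : nat -> R) (A B W : R) :
  A <> 0 -> (forall k, A * v k - B * u k = g (S k) - g k) ->
  g O = 0 -> is_lim_seq g 0 -> is_series u W -> is_series v (B / A * W).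
Proof.
  intros HA Hc H0 Hg Hu.
  assert (Hv : forall k, B / A * u k + / A * (g (S k) - g k) = v k).
  { intros k; rewrite <- Hc; field; exact HA. }
  apply (is_series_ext _ _ _ Hv).
  replace (B / A * W) with (B / A * W + / A * (- g O - - 0)) by (rewrite H0; ring).
  apply (is_series_plus (V := R_NormedModule)); apply (is_series_scal (V := R_NormedModule)).
  - exact Hu.
  - apply (is_series_telescope _ (fun k => - g k)); [intros k; ring|].
    apply (is_lim_seq_opp g 0) in Hg; exact Hg.
Qed.

(** Domination travels with the sum because the next shift uses it to dispose of its boundary
    term. *)
Definition watson_sum (a b c W : R) : Prop :=
  dominated (watson_term a b c) base_term /\ is_series (watson_term a b c) W.

Lemma watson_sum_sym (a b c W : R) : watson_sum a b c W -> watson_sum b a c W.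
Proof.
  intros [[M [HM Hd]] Hs]; split.
  - exists M; split; [exact HM|]; intros k; rewrite watson_term_sym; apply Hd.
  - apply is_series_ext with (2 := Hs); intros k; symmetry; apply watson_term_sym.
Qed.

(** The contiguous relation has the certificate passed to [is_series_contiguous]. The bounds on a +
    b keep its rational factor in [0, 1] and the denominators positive. *)
Lemma watson_sum_shift_c (a b c W : R) :
  0 < a -> 0 < b -> 1 <= a + b <= 2 * c ->
  watson_sum a b c W ->
  watson_sum a b (c + 1)
    ((2 * c + 1) * (2 * c + 1 - a - b) / ((2 * c + 1 - a) * (2 * c + 1 - b)) * W).
Proof.
  intros Ha Hb [Hab Hc] [Hd Hs]; assert (Hc0 : 0 < c) by lra; split.
  - apply dominated_trans with (2 := Hd).
    exists (2 * (2 * c + 1)); split; [lra|]; intros k; pose proof (pos_INR k).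
    rewrite watson_term_shift_c, Rmult_comm by lra.
    apply Rmult_le_compat_r; [apply Rlt_le, watson_term_pos; lra|].
    apply Rle_div_l; [nra|]. apply Rmult_le_compat_l; [lra|]. nra.
  - replace ((2 * c + 1) * (2 * c + 1 - a - b) / ((2 * c + 1 - a) * (2 * c + 1 - b)))
      with (((2 * c + 1 - a - b) / 2)
            / ((2 * c + 1 - a) * (2 * c + 1 - b) / (2 * (2 * c + 1)))) by (field; lra).
    apply (is_series_contiguous (watson_term a b c) _
      (fun k => watson_term a b c k * INR k * ((a + b + 1) / 2 - 1 + INR k) / (2 * c + INR k))).
    + apply Rgt_not_eq, Rdiv_lt_0_compat; [apply Rmult_lt_0_compat|]; lra.
    + intros k; pose proof (pos_INR k).
      rewrite watson_term_shift_c, watson_term_S, S_INR by lra; field; lra.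
    + simpl; field; lra.
    + apply (is_lim_seq_dominated (watson_term a b c) _ 1); [exact Hd| |lra].
      intros k; pose proof (pos_INR k) as Hk.
      pose proof (watson_term_pos a b c k Ha Hb Hc0) as Hp.
      assert (H : 0 <= ((a + b + 1) / 2 - 1 + INR k) / (2 * c + INR k) <= 1).
      { split; [apply Rcomplements.Rdiv_le_0_compat|apply Rle_div_l]; lra. }
      replace (watson_term a b c k * INR k * ((a + b + 1) / 2 - 1 + INR k) / (2 * c + INR k))
        with (((a + b + 1) / 2 - 1 + INR k) / (2 * c + INR k) * (INR k * watson_term a b c k))
        by (field; lra).
      pose proof (Rmult_le_pos _ _ Hk (Rlt_le _ _ Hp)).
      split; [apply Rmult_le_pos|apply Rmult_le_compat_r]; lra.
    + exact Hs.
Qed.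

(** Same scheme with another certificate, now negative; its rational factor is at most 2 because a
    <= 2c. *)
Lemma watson_sum_shift_a (a b c W : R) :
  0 < a -> 0 < b -> 1 <= a + b <= 2 * c ->
  watson_sum a b c W ->
  watson_sum (a + 2) b (c + 1)
    ((a + b + 1) * (2 * c + 1) / ((a + 1) * (2 * c + 1 - b)) * W).
Proof.
  intros Ha Hb [Hab Hc] [Hd Hs]; assert (Hc0 : 0 < c) by lra; split.
  - apply dominated_trans with (2 := Hd).
    exists ((2 * c + 1) * (a + b + 1) * (2 * c + 1) / (a * (a + 1))).
    split; [apply Rlt_le, Rdiv_lt_0_compat; [repeat apply Rmult_lt_0_compat|apply Rmult_lt_0_compat]; lra|].
    intros k; pose proof (pos_INR k).
    rewrite watson_term_shift_a, Rmult_comm by lra.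
    apply Rmult_le_compat_r; [apply Rlt_le, watson_term_pos; lra|].
    set (x := INR k) in *.
    set (K := (a + b + 1) * (2 * c + 1) / (a * (a + 1))).
    assert (HK : 0 < K) by (apply Rdiv_lt_0_compat; apply Rmult_lt_0_compat; lra).
    (* The ratio is split into a constant [K], a quotient bounded by 2c + 1 as (a+b+1)/2 >= 1, and
       two quotients bounded by 1 as a <= 2c. *)
    replace ((a + x) * (a + 1 + x) * (c + x) * ((a + b + 1) * (2 * c + 1))
             / (a * (a + 1) * ((a + b + 1) / 2 + x) * ((2 * c + x) * (2 * c + 1 + x))))
      with (K * ((c + x) / ((a + b + 1) / 2 + x)
                 * ((a + x) / (2 * c + x) * ((a + 1 + x) / (2 * c + 1 + x)))))
      by (unfold K; field; lra).
    replace ((2 * c + 1) * (a + b + 1) * (2 * c + 1) / (a * (a + 1)))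
      with (K * ((2 * c + 1) * (1 * 1))) by (unfold K; field; lra).
    apply Rmult_le_compat_l; [lra|].
    assert (Hq : forall p q, 0 < p <= q -> 0 <= p / q <= 1).
    { intros p q Hpq; split; [apply Rcomplements.Rdiv_le_0_compat|apply Rle_div_l]; lra. }
    assert (H1 := Hq (a + x) (2 * c + x) ltac:(lra)).
    assert (H2 := Hq (a + 1 + x) (2 * c + 1 + x) ltac:(lra)).
    apply Rmult_le_compat.
    + apply Rcomplements.Rdiv_le_0_compat; lra.
    + apply Rmult_le_pos; lra.
    + apply Rle_div_l; nra.
    + apply Rmult_le_compat; lra.
  - replace ((a + b + 1) * (2 * c + 1) / ((a + 1) * (2 * c + 1 - b)))
      with (a / (a * (a + 1) * (2 * c + 1 - b) / ((a + b + 1) * (2 * c + 1)))) by (field; lra).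
    apply (is_series_contiguous (watson_term a b c) _
      (fun k => - (watson_term a b c k * INR k * (a + 2 * c + 2 * INR k) / (2 * c + INR k)))).
    + apply Rgt_not_eq, Rdiv_lt_0_compat; repeat apply Rmult_lt_0_compat; lra.
    + intros k; pose proof (pos_INR k).
      rewrite watson_term_shift_a, watson_term_S, S_INR by lra; field; lra.
    + simpl; field; lra.
    + rewrite <- Ropp_0; apply (is_lim_seq_opp _ 0).
      apply (is_lim_seq_dominated (watson_term a b c) _ 2); [exact Hd| |lra].
      intros k; pose proof (pos_INR k) as Hk.
      pose proof (watson_term_pos a b c k Ha Hb Hc0) as Hp.
      assert (H : 0 <= (a + 2 * c + 2 * INR k) / (2 * c + INR k) <= 2).
      { split; [apply Rcomplements.Rdiv_le_0_compat|apply Rle_div_l]; lra. }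
      replace (watson_term a b c k * INR k * (a + 2 * c + 2 * INR k) / (2 * c + INR k))
        with ((a + 2 * c + 2 * INR k) / (2 * c + INR k) * (INR k * watson_term a b c k))
        by (field; lra).
      pose proof (Rmult_le_pos _ _ Hk (Rlt_le _ _ Hp)).
      split; [apply Rmult_le_pos|apply Rmult_le_compat_r]; lra.
    + exact Hs.
Qed.

(** * The two starting values *)

Lemma watson_sum_1 : watson_sum 1 1 1 (PI ^ 2 / 4).
Proof.
  assert (H : forall k, base_term k = watson_term 1 1 1 k).
  { intros k; unfold base_term, wallis, watson_term; pose proof (pos_INR k).
    replace ((1 + 1 + 1) / 2) with (3 / 2) by field.
    replace (2 * 1) with (1 + 1) by ring.
    rewrite rpoch_add1, !rpoch_1 by lra; field.
    repeat split; try lra; try (apply rpoch_neq0; lra); apply INR_fact_neq_0. }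
  split.
  - exists 1; split; [lra|]; intros k; rewrite H; lra.
  - apply is_series_ext with (1 := H), base_series.
Qed.

Lemma watson_term_2 (k : nat) :
  watson_term 2 2 2 k
  = 9 * (INR k + 1) ^ 2 * wallis k / ((INR k + 3 / 2) * (INR k + 2) * (INR k + 3)).
Proof.
  unfold wallis, watson_term; pose proof (pos_INR k).
  replace ((2 + 2 + 1) / 2) with (3 / 2 + 1) by field.
  replace (2 * 2) with (1 + 1 + 1 + 1) by ring.
  replace 2 with (1 + 1) by ring.
  rewrite !rpoch_add1, !rpoch_1 by lra; field.
  repeat split; try lra; try (apply rpoch_neq0; lra); apply INR_fact_neq_0.
Qed.

Lemma watson_sum_2 : watson_sum 2 2 2 9.
Proof.
  split.
  - exists 9; split; [lra|]; intros k; rewrite watson_term_2; unfold base_term.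
    pose proof (pos_INR k) as Hk; pose proof (wallis_pos k) as Hw.
    apply Rminus_le_0.
    replace (_ - _) with (9 * wallis k *
      ((INR k + 3 / 2) * (INR k + 2) * (INR k + 3) - (INR k + 1) ^ 3)
      / ((INR k + 1) * ((INR k + 3 / 2) * (INR k + 2) * (INR k + 3)))) by (field; lra).
    apply Rcomplements.Rdiv_le_0_compat.
    + apply Rmult_le_pos; [lra|nra].
    + repeat apply Rmult_lt_0_compat; lra.
  (* An explicit antidifference of the summand; its value at 0 is the sum 9. *)
  - set (g := fun k => 18 * (INR k + 1) / (INR k + 2) * wallis k).
    replace 9 with (g O - 0) by (unfold g, wallis; simpl; field).
    apply is_series_telescope.
    + intros k; unfold g; rewrite watson_term_2, wallis_S, S_INR.
      pose proof (pos_INR k); field; lra.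
    + apply (is_lim_seq_le_le (fun _ => 0) _ (fun k => 18 * wallis k)).
      * intros k; unfold g; pose proof (pos_INR k) as Hk; pose proof (wallis_pos k).
        assert (0 <= 18 * (INR k + 1) / (INR k + 2) <= 18).
        { split; [apply Rcomplements.Rdiv_le_0_compat|apply Rle_div_l]; lra. }
        split; [apply Rmult_le_pos|apply Rmult_le_compat_r]; lra.
      * apply is_lim_seq_const.
      * replace (Finite 0) with (Rbar_mult 18 0) by (simpl; f_equal; ring).
        apply is_lim_seq_scal_l, wallis_lim.
Qed.

(** * Watson's sum along the lattice of shifts *)

(** The accumulated product of the shift factors starting from (r, r, r); it is used at r = 1 and r
    = 2. *)
Definition watson_ratio (r : R) (m n s : nat) : R :=
  rpoch (r + 1 / 2) (m + n + s) * rpoch (r + 1 / 2) (m + n) * rpoch (1 / 2) s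
  / (rpoch ((r + 1) / 2) m * rpoch ((r + 1) / 2) n
     * rpoch ((r + 1) / 2) (m + s) * rpoch ((r + 1) / 2) (n + s)).

Lemma watson_ratio_sym (r : R) (m n s : nat) : watson_ratio r m n s = watson_ratio r n m s.
Proof.
  unfold watson_ratio; rewrite (Nat.add_comm m n); f_equal; ring.
Qed.

(** The path makes m shifts in a, then n in b, then s in c. Along it a + b <= 2c persists, with
    equality until c moves alone, and r >= 1/2 gives a + b >= 1. *)
Lemma watson_sum_general (r W : R) (m n s : nat) :
  1 / 2 <= r -> watson_sum r r r W ->
  watson_sum (r + 2 * INR m) (r + 2 * INR n) (r + INR m + INR n + INR s)
    (W * watson_ratio r m n s).
Proof.
  intros Hr H0.
  assert (Hstep : forall m n,
    watson_sum (r + 2 * INR m) (r + 2 * INR n) (r + INR m + INR n) (W * watson_ratio r m n 0) ->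
    watson_sum (r + 2 * INR (S m)) (r + 2 * INR n) (r + INR (S m) + INR n)
      (W * watson_ratio r (S m) n 0)).
  { clear m n s; intros m n Hmn; pose proof (pos_INR m); pose proof (pos_INR n).
    apply watson_sum_shift_a in Hmn; try lra.
    rewrite S_INR.
    replace (r + 2 * (INR m + 1)) with (r + 2 * INR m + 2) by ring.
    replace (r + (INR m + 1) + INR n) with (r + INR m + INR n + 1) by ring.
    match type of Hmn with watson_sum _ _ _ ?x =>
      match goal with |- watson_sum _ _ _ ?y => replace y with x; [exact Hmn|] end end.
    unfold watson_ratio; rewrite !Nat.add_0_r; simpl rpoch; rewrite !plus_INR.
    field; repeat split; try lra; apply rpoch_neq0; lra. }
  assert (Hm : watson_sum (r + 2 * INR m) (r + 2 * INR 0) (r + INR m + INR 0)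
                 (W * watson_ratio r m 0 0)).
  { induction m as [|m IH]; [|apply Hstep, IH].
    replace (W * watson_ratio r 0 0 0) with W by (unfold watson_ratio; simpl; field).
    simpl INR; rewrite Rmult_0_r, !Rplus_0_r; exact H0. }
  assert (Hn : watson_sum (r + 2 * INR m) (r + 2 * INR n) (r + INR m + INR n)
                 (W * watson_ratio r m n 0)).
  { clear s; induction n as [|n IH]; [exact Hm|].
    (* A shift in b is a shift in a after exchanging the two. *)
    apply watson_sum_sym; rewrite watson_ratio_sym.
    replace (r + INR m + INR (S n)) with (r + INR (S n) + INR m) by ring.
    apply Hstep, watson_sum_sym; rewrite watson_ratio_sym.
    replace (r + INR n + INR m) with (r + INR m + INR n) by ring; exact IH. }
  induction s as [|s IH].
  - simpl INR; rewrite Rplus_0_r; exact Hn.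
  - pose proof (pos_INR m); pose proof (pos_INR n); pose proof (pos_INR s).
    apply watson_sum_shift_c in IH; try lra.
    rewrite S_INR, <- Rplus_assoc.
    match type of IH with watson_sum _ _ _ ?x =>
      match goal with |- watson_sum _ _ _ ?y => replace y with x; [exact IH|] end end.
    unfold watson_ratio; rewrite !Nat.add_succ_r; simpl rpoch; rewrite !plus_INR.
    field; repeat split; try lra; apply rpoch_neq0; lra.
Qed.

(** * Passage to complex series and the dependence on d *)

Lemma is_series_RtoC (u : nat -> R) (l : R) :
  is_series u l ->
  is_series (K := C_AbsRing) (V := C_NormedModule) (fun k => RtoC (u k)) (RtoC l).
Proof.
  intros Hu.
  unfold is_series.
  apply (filterlim_ext (fun n => RtoC (sum_n u n))).
  - intros n; induction n as [|n IH]; [rewrite !sum_O; reflexivity|].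
    rewrite !sum_Sn, <- IH; apply RtoC_plus.
  - refine (filterlim_comp _ _ _ _ RtoC _ _ _ Hu _).
    intros P [eps HP]; exists eps; intros y Hy; apply HP.
    split; [exact Hy|apply ball_center].
Qed.

Lemma poch_RtoC (a : R) (k : nat) : poch (RtoC a) k = RtoC (rpoch a k).
Proof.
  induction k as [|k IH]; [reflexivity|].
  simpl poch; simpl rpoch; rewrite IH, RtoC_mult, RtoC_plus; reflexivity.
Qed.

Lemma poch_neq0 (d : C) (k : nat) : 0 < Re d -> poch d k <> 0%C.
Proof.
  intros Hd; induction k as [|k IH]; simpl poch.
  - intros H; apply RtoC_inj in H; lra.
  - apply Cmult_neq_0; [exact IH|]; intros H.
    apply (f_equal Re) in H; simpl in H; pose proof (pos_INR k); unfold Re in Hd; lra.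
Qed.

Lemma poch_shift (d : C) (k : nat) : (d * poch (d + 1) k = poch d k * (d + INR k))%C.
Proof.
  induction k as [|k IH]; [simpl; ring|].
  rewrite S_INR, RtoC_plus; simpl poch.
  rewrite Cmult_assoc, IH; ring.
Qed.

(* This is [k t_k], where [t_k] is the summand of the 3F2 with lower
   parameters (a+b+1)/2 and 2c+1, one off from Watson's 2c. *)
Definition shifted_term (a b c : R) (k : nat) : R :=
  INR k * (2 * c / (2 * c + INR k) * watson_term a b c k).

(** The factor k kills the first summand and lowers k! to (k-1)!. Shifting the index then raises
    every parameter by one, and (a+b+3)/2, 2c+2 are again the lower parameters of Watson's form. *)
Lemma shifted_term_series (a b c W : R) :
  0 < a -> 0 < b -> 0 < c ->
  is_series (watson_term (a + 1) (b + 1) (c + 1)) W ->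
  is_series (shifted_term a b c) (2 * a * b * c / ((a + b + 1) * (2 * c + 1)) * W).
Proof.
  intros Ha Hb Hc HW.
  apply is_series_decr_1.
  replace (plus _ (opp (shifted_term a b c 0)))
    with (2 * a * b * c / ((a + b + 1) * (2 * c + 1)) * W)
    by (unfold shifted_term, plus, opp; simpl; ring).
  assert (H : forall k, 2 * a * b * c / ((a + b + 1) * (2 * c + 1))
                          * watson_term (a + 1) (b + 1) (c + 1) k
                        = shifted_term a b c (S k)).
  { intros k; unfold shifted_term; pose proof (pos_INR k).
    rewrite watson_term_S, S_INR by lra; unfold watson_term.
    replace ((a + 1 + (b + 1) + 1) / 2) with ((a + b + 1) / 2 + 1) by field.
    replace (2 * (c + 1)) with (2 * c + 1 + 1) by ring.
    rewrite !rpoch_add1 by lra; field.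
    repeat split; try lra; try (apply rpoch_neq0; lra); apply INR_fact_neq_0. }
  apply (is_series_ext _ _ _ H).
  apply (is_series_scal (V := R_NormedModule)), HW.
Qed.

(** With t_k the 3F2 summand with lower parameter 2c+1, Watson's summand is (1 + k/(2c)) t_k. Hence
    (1 + k/d) t_k is Watson's summand plus (1/d - 1/(2c)) k t_k. *)
Lemma is_pFq_contiguous_watson (a b c W V : R) (d : C) :
  0 < a -> 0 < b -> 0 < c -> 0 < Re d ->
  is_series (watson_term a b c) W -> is_series (shifted_term a b c) V ->
  is_pFq [RtoC a; RtoC b; RtoC c; (d + 1)%C]
    [RtoC ((a + b + 1) / 2); RtoC (2 * c + 1); d] 1
    (W + (1 / d - 1 / RtoC (2 * c)) * V)%C.
Proof.
  intros Ha Hb Hc Hd HW HV; unfold is_pFq.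
  assert (Hd0 : d <> 0%C) by (exact (fun H => Rlt_irrefl 0 (eq_ind _ (fun z => 0 < Re z) Hd _ H))).
  apply is_series_RtoC in HW; apply is_series_RtoC in HV.
  apply (is_series_scal (V := C_NormedModule) (1 / d - 1 / RtoC (2 * c))%C) in HV.
  refine (is_series_ext _ _ _ _ (is_series_plus _ _ _ _ HW HV)).
  intros k.
  change (RtoC (watson_term a b c k) + (1 / d - 1 / RtoC (2 * c)) * RtoC (shifted_term a b c k)
          = pFq_term [RtoC a; RtoC b; RtoC c; d + 1]
              [RtoC ((a + b + 1) / 2); RtoC (2 * c + 1); d] 1 k)%C.
  unfold pFq_term; simpl map; unfold Cprod, fold_right.
  rewrite !poch_RtoC, Cpow_1_l.
  pose proof (pos_INR k) as Hk.
  assert (Hp := poch_neq0 d k Hd).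
  replace (poch (d + 1) k) with (poch d k * (d + INR k) / d)%C
    by (rewrite <- poch_shift; field; exact Hd0).
  rewrite rpoch_add1 by lra; unfold shifted_term.
  set (e := (a + b + 1) / 2) in *.
  assert (He : RtoC (rpoch e k) <> 0%C)
    by (intros H; apply RtoC_inj in H; revert H; apply rpoch_neq0; unfold e; lra).
  assert (H2 : RtoC (rpoch (2 * c) k) <> 0%C)
    by (intros H; apply RtoC_inj in H; revert H; apply rpoch_neq0; lra).
  assert (Hf : RtoC (INR (fact k)) <> 0%C)
    by (intros H; apply RtoC_inj in H; revert H; apply INR_fact_neq_0).
  assert (Hc2 : RtoC c <> 0%C) by (intros H; apply RtoC_inj in H; lra).
  assert (Hck : RtoC (2 * c + INR k) <> 0%C) by (intros H; apply RtoC_inj in H; lra).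
  assert (Ht : RtoC (watson_term a b c k)
    = (RtoC (rpoch a k) * RtoC (rpoch b k) * RtoC (rpoch c k)
       / (RtoC (rpoch e k) * RtoC (rpoch (2 * c) k) * RtoC (INR (fact k))))%C).
  { unfold watson_term; fold e; rewrite RtoC_div, !RtoC_mult; [reflexivity|].
    repeat apply Rmult_integral_contrapositive_currified;
      try (apply rpoch_neq0; unfold e; lra); apply INR_fact_neq_0. }
  rewrite !RtoC_mult, !RtoC_div, !RtoC_mult, Ht by lra.
  rewrite (RtoC_plus (2 * c)) in *; rewrite !RtoC_mult in *.
  field; repeat split; auto.
Qed.

(** * Closed forms and the final assembly *)

Lemma watson_ratio_1 (m n s : nat) :
  watson_ratio 1 m n s
  = rpoch (3 / 2) (m + n + s) * rpoch (3 / 2) (m + n) * rpoch (1 / 2) s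
    / (INR (fact m) * INR (fact n) * INR (fact (m + s)) * INR (fact (n + s))).
Proof.
  unfold watson_ratio.
  replace (1 + 1 / 2) with (3 / 2) by field.
  replace ((1 + 1) / 2) with 1 by field.
  rewrite !rpoch_1; reflexivity.
Qed.

(** Expressed in the symbols of the final formula; the remaining linear factors are a, b, a+b+1 and
    2c+1 for the parameters at r = 1, and cancel against the prefactor in [shifted_term_series]. *)
Lemma watson_ratio_2 (m n s : nat) :
  9 * watson_ratio 2 m n s
  = rpoch (3 / 2) (m + n + s) * rpoch (3 / 2) (m + n) * rpoch (1 / 2) s
    * (2 * INR m + 2 * INR n + 3) * (2 * INR m + 2 * INR n + 2 * INR s + 3)
    / (4 * (2 * INR m + 1) * (2 * INR n + 1)
       * rpoch (1 / 2) m * rpoch (1 / 2) n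
       * rpoch (1 / 2) (m + s + 1) * rpoch (1 / 2) (n + s + 1)).
Proof.
  pose proof (pos_INR m); pose proof (pos_INR n); pose proof (pos_INR s).
  unfold watson_ratio; rewrite !Nat.add_1_r; simpl rpoch.
  replace (2 + 1 / 2) with (3 / 2 + 1) by field.
  replace ((2 + 1) / 2) with (1 / 2 + 1) by field.
  rewrite !rpoch_add1, !plus_INR by lra.
  field; repeat split; try lra; apply rpoch_neq0; lra.
Qed.

Open Scope C_scope.

Theorem theorem5 (m n s : nat) (d : C) (Hd : (0 < Re d)%R) :
  is_pFq
    [1 + 2 * INR m; 1 + 2 * INR n; 1 + INR m + INR n + INR s; d + 1]
    [INR m + INR n + 3 / 2; 3 + 2 * INR m + 2 * INR n + 2 * INR s; d]
    1
    (PI / 4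
     * (poch (3 / 2) (m + n + s) * poch (3 / 2) (m + n) * poch (1 / 2) s
        / (poch (1 / 2) m * poch (1 / 2) n * INR (fact m) * INR (fact n)))
     * (PI * (poch (1 / 2) m * poch (1 / 2) n
              / (INR (fact (m + s)) * INR (fact (n + s))))
        + 1 / PI
          * (((2 + 2 * INR m + 2 * INR n + 2 * INR s) / d - 1)
             * INR (fact m) * INR (fact n)
             / (poch (1 / 2) (m + s + 1) * poch (1 / 2) (n + s + 1))))).
Proof.
  pose proof (pos_INR m) as Hm; pose proof (pos_INR n) as Hn; pose proof (pos_INR s) as Hs.
  assert (H1 := watson_sum_general 1 _ m n s ltac:(lra) watson_sum_1).
  assert (H2 := watson_sum_general 2 _ m n s ltac:(lra) watson_sum_2).
  rewrite watson_ratio_1 in H1; rewrite watson_ratio_2 in H2.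
  set (a := (1 + 2 * INR m)%R) in *; set (b := (1 + 2 * INR n)%R) in *.
  set (c := (1 + INR m + INR n + INR s)%R) in *.
  (* The parameters at r = 2 exceed those at r = 1 by one each, as the index shift requires. *)
  replace (2 + 2 * INR m)%R with (a + 1)%R in H2 by (unfold a; ring).
  replace (2 + 2 * INR n)%R with (b + 1)%R in H2 by (unfold b; ring).
  replace (2 + INR m + INR n + INR s)%R with (c + 1)%R in H2 by (unfold c; ring).
  apply proj2 in H1; apply proj2, shifted_term_series in H2; try (unfold a, b, c; lra).
  assert (H := is_pFq_contiguous_watson a b c _ _ d
                 ltac:(unfold a; lra) ltac:(unfold b; lra) ltac:(unfold c; lra) Hd H1 H2).
  assert (Hne : forall x : R, x <> 0%R -> RtoC x <> 0)
    by (intros x Hx Hx0; apply Hx, RtoC_inj, Hx0).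
  assert (E32 : 3 / 2 = RtoC (3 / 2)) by (rewrite RtoC_div by lra; reflexivity).
  assert (E12 : 1 / 2 = RtoC (1 / 2)) by (rewrite RtoC_div by lra; reflexivity).
  rewrite E32, E12, !poch_RtoC.
  replace (1 + 2 * INR m) with (RtoC a) by (unfold a; rewrite RtoC_plus, RtoC_mult; reflexivity).
  replace (1 + 2 * INR n) with (RtoC b) by (unfold b; rewrite RtoC_plus, RtoC_mult; reflexivity).
  replace (1 + INR m + INR n + INR s) with (RtoC c)
    by (unfold c; rewrite !RtoC_plus; reflexivity).
  replace (INR m + INR n + RtoC (3 / 2)) with (RtoC ((a + b + 1) / 2))
    by (rewrite <- !RtoC_plus; f_equal; unfold a, b; field).
  replace (3 + 2 * INR m + 2 * INR n + 2 * INR s) with (RtoC (2 * c + 1))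
    by (rewrite <- !RtoC_mult, <- !RtoC_plus; f_equal; unfold c; ring).
  replace (2 + 2 * INR m + 2 * INR n + 2 * INR s) with (RtoC (2 * c))
    by (rewrite <- !RtoC_mult, <- !RtoC_plus; f_equal; unfold c; ring).
  match type of H with is_pFq _ _ _ ?x =>
    match goal with |- is_pFq _ _ _ ?y => replace y with x; [exact H|] end end.
  assert (Hc : RtoC (2 * c) <> 0) by (apply Hne; unfold c; lra).
  assert (Hd0 : d <> 0) by (intros ->; simpl in Hd; lra).
  set (P := (rpoch (3 / 2) (m + n + s) * rpoch (3 / 2) (m + n) * rpoch (1 / 2) s)%R).
  assert (Hhalf : forall k, rpoch (1 / 2) k <> 0%R) by (intros k; apply rpoch_neq0; lra).
  pose proof PI_neq0 as Hpi.
  (* [Q] is the prefactor of the claim, [X] and [Y] the parts of its bracket free of d. Watson's sum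
     is Q X and the shifted sum 2c Q Y, so the value is Q (X + (2c/d - 1) Y). *)
  set (X := (PI * (rpoch (1 / 2) m * rpoch (1 / 2) n / (INR (fact (m + s)) * INR (fact (n + s)))))%R).
  set (Y := (INR (fact m) * INR (fact n)
             / (PI * (rpoch (1 / 2) (m + s + 1) * rpoch (1 / 2) (n + s + 1))))%R).
  set (Q := (PI / 4 * (P / (rpoch (1 / 2) m * rpoch (1 / 2) n * INR (fact m) * INR (fact n))))%R).
  match goal with |- RtoC ?u + _ * RtoC ?v = _ =>
    replace u with (Q * X)%R; [replace v with (2 * c * (Q * Y))%R|] end.
  2:{ unfold Q, Y, a, b, c; field; repeat split; try lra; try apply Hhalf; try apply INR_fact_neq_0; auto. }
  2:{ unfold Q, X, P; field; repeat split; try lra; try apply Hhalf; try apply INR_fact_neq_0. }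
  transitivity (RtoC Q * (RtoC X + (RtoC (2 * c) / d - 1) * RtoC Y)).
  - rewrite !(RtoC_mult _ (Q * Y)), !(RtoC_mult Q); field; auto.
  - unfold Q, X, Y, P.
    rewrite !RtoC_mult, !RtoC_div, !RtoC_mult;
      repeat (exact Hpi || apply Rmult_integral_contrapositive_currified);
      try apply Hhalf; try apply INR_fact_neq_0; try lra; auto.
    field; repeat split; try apply Hne; try apply Hhalf; try apply INR_fact_neq_0; auto.
Qed.
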